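(* Let $E\subseteq\mathbb{N}$ be a set that is not Besicovitch. For a sequence $(K_i)_{i\ge1}$ of natural numbers put $E_i=E\cap[1,K_i)$, let $\emptyset\ne A_i\subseteq[K_i,\infty)\cap\mathbb{N}$ for $i\ge1$, and let $B=\bigcup_{i\ge1}E_iA_i$. Then, for large enough $K_i$ (meaning: provided each $K_i$ exceeds a suitable bound depending only on $E$, $i$ and $K_1,\dots,K_{i-1}$, and with the sets $A_i$ otherwise arbitrary), we have $\overline{d}(\mathcal{M}_E\setminus\mathcal{M}_B)>0$. If additionally $E$ is taut and all $A_i$ are Behrend sets, then $B'=E$.
   Context: $\mathbb{N}=\{1,2,\dots\}$. For $X,Y\subseteq\mathbb{N}$ and $c\in\mathbb{N}$, $XY=\{xy:x\in X,y\in Y\}$ and $cX=\{cx:x\in X\}$. For $B\subseteq\mathbb{N}$ let $\mathcal{M}_B=\bigcup_{b\in B}b\mathbb{Z}$. For $A\subseteq\mathbb{Z}$, $\overline{d}(A)=\limsup_{n\to\infty}\frac1n|A\cap[1,n]|$, the natural density $d(A)$ is the corresponding limit (if it exists), and the logarithmic density is $\delta(A)=\lim_{n\to\infty}\frac{1}{\ln n}\sum_{1\le k\le n,\,k\in A}\frac1k$; $\delta(\mathcal{M}_B)$ exists for every $B\subseteq\mathbb{N}$ (Davenport--Erdős). $B$ is Besicovitch if $d(\mathcal{M}_B)$ exists. $B$ is taut if $\delta(\mathcal{M}_{B\setminus\{b\}})<\delta(\mathcal{M}_B)$ for every $b\in B$. $B$ is Behrend if $B\subseteq\mathbb{N}\setminus\{1\}$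 and $\delta(\mathcal{M}_B)=1$. $B^{prim}=B\setminus\bigcup_{k\ge2}kB$. Tautification: put $C(B)=\{c\in\mathbb{N}: cA\subseteq B\text{ for some Behrend set }A\}$; the tautification of $B$ is $B'=(B\cup C(B))^{prim}$. (Equivalently, $B'$ is the unique taut set whose Mirsky measure equals that of $B$, where the Mirsky measure of $B$ is the shift-invariant measure on $\{0,1\}^{\mathbb{Z}}$ for which $\mathbf{1}_{\mathbb{Z}\setminus\mathcal{M}_B}$ is quasi-generic along any sequence realizing the lower density of $\mathcal{M}_B$.) *)

(* Defs.v *)
From HB Require Import structures.
From mathcomp Require Import all_boot all_order all_algebra.
From mathcomp Require Import all_classical all_reals all_analysis.

Set Implicit Arguments.
Unset Strict Implicit.
Unset Printing Implicit Defensive.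

Import Order.TTheory GRing.Theory Num.Theory.
Import numFieldNormedType.Exports.

Local Open Scope classical_set_scope.
Local Open Scope ring_scope.

(* Subsets of N = {1, 2, ...} are sets of type [set nat] included in [posn]. *)
Definition posn : set nat := [set n | (0 < n)%N].

Definition prodset (X Y : set nat) : set nat :=
  [set (x * y)%N | x in X & y in Y].

Definition dilate (c : nat) (X : set nat) : set nat := [set (c * x)%N | x in X].

Definition multiples (B : set nat) : set int :=
  \bigcup_(b in B) [set z : int | (b%:Z %| z)%Z].

Section Densities.
Variable R : realType.
Implicit Type A : set int.

Definition freq A (n : nat) : R :=
  (\sum_(1 <= k < n.+1 | (k%:Z : int) \in A) 1)%N%:R / n%:R.

(* [limn_sup] is meaningful for bounded sequences only; here 0 <= freq <= 1. *)
Definition upper_density A : R := limn_sup (freq A).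

Definition has_density A : Prop := cvgn (freq A).

(* Only used for [A = multiples B], where the limit exists by the
   Davenport-Erdos theorem, so the default value of [limn] is irrelevant. *)
Definition log_density A : R :=
  limn (fun n : nat =>
    (\sum_(1 <= k < n.+1 | (k%:Z : int) \in A) k%:R^-1) / ln (n%:R : R)).

End Densities.

Section SetsOfMultiples.
Variable R : realType.
Implicit Types A B : set nat.

Definition besicovitch B : Prop := has_density R (multiples B).

Definition taut B : Prop :=
  forall b, B b ->
    log_density R (multiples (B `\ b)) < log_density R (multiples B).

Definition behrend A : Prop :=
  A `<=` posn `\ 1%N /\ log_density R (multiples A) = 1.

Definition primitive_part B : set nat :=
  B `\` \bigcup_(k in [set k | (2 <= k)%N]) dilate k B.

Definition behrend_divisors B : set nat :=
  [set c | posn c /\ exists A, behrend A /\ dilate c A `<=` B].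

Definition tautification B : set nat :=
  primitive_part (B `|` behrend_divisors B).

End SetsOfMultiples.

(* Main.v *)
(* If freq (multiples E) oscillates between a and b > a, then a finite part of E
   has a periodic set of multiples, of density at most a.  Choose n_j with
   freq (multiples E) n_j > b once K_1, ..., K_(j-1) are known, and K_j > n_j:
   up to n_j the multiples of B are multiples of elements of E below
   max_(i < j) K_i, and thus miss a positive proportion of multiples E.

   The tautification reduces to: if E is taut, A is Behrend and c A lies in the
   multiples of E, then c is a multiple of an element of E.  This rests on the
   fact that a finite union of non-Behrend sets is non-Behrend.  On the
   probability spaces with weights k^(-1-s) / zeta(1+s) the valuations at the
   primes are independent, so Harris' correlation inequality bounds below the
   probability of avoiding a union by the product of the probabilities.  It also
   shows that the probability of avoiding a set of multiples is monotone in s,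
   which allows the passage between s -> 0 and logarithmic density zero. *)
Require Import Defs.
From HB Require Import structures.
From mathcomp Require Import all_boot all_order all_algebra.
From mathcomp Require Import all_classical all_reals all_analysis.
From mathcomp Require Import ring lra zify.

Import Order.TTheory GRing.Theory Num.Theory.
Import numFieldNormedType.Exports.

Local Open Scope classical_set_scope.
Local Open Scope ring_scope.

(** * Harris' correlation inequality on grids of smooth numbers *)

Lemma chebyshev_sum (R : realDomainType) (I : Type) (s : seq I)
    (w a b : I -> R) :
  (forall i, 0 <= w i) -> (forall i j, 0 <= (a i - a j) * (b i - b j)) ->
  (\sum_(i <- s) w i * a i) * (\sum_(i <- s) w i * b i) <=
  (\sum_(i <- s) w i) * (\sum_(i <- s) w i * (a i * b i)).
Proof.
move=> w0 ab; elim: s => [|x s IH]; first by rewrite !big_nil !mul0r.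
rewrite !big_cons.
(* Adding [x] changes the gap between the two sides by [w x] times this quantity, which is the sum
   of w_i (a_i - a_x)(b_i - b_x). *)
have : 0 <= (\sum_(i <- s) w i) * (a x * b x) + \sum_(i <- s) w i * (a i * b i)
    - (\sum_(i <- s) w i * a i) * b x - (\sum_(i <- s) w i * b i) * a x.
  rewrite !mulr_suml -big_split /= -!sumrB; apply: sumr_ge0 => i _.
  have := mulr_ge0 (w0 i) (ab i x).
  by congr (_ <= _); ring.
move=> /(mulr_ge0 (w0 x)); move: IH.
set W := \sum_(i <- s) w i; set P := \sum_(i <- s) w i * (a i * b i).
set A := \sum_(i <- s) w i * a i; set B := \sum_(i <- s) w i * b i.
by nra.
Qed.

Definition dvd_antitone {R : realType} (f : nat -> R) :=
  forall k n, (0 < k)%N -> (0 < n)%N -> f (k * n)%N <= f n.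

(** Positive correlation under the weights [w] on [s], cleared of the normalising total mass. *)
Definition harris {R : realType} (w : nat -> R) (s : seq nat) :=
  forall f g : nat -> R, dvd_antitone f -> dvd_antitone g ->
  (\sum_(n <- s) w n * f n) * (\sum_(n <- s) w n * g n) <=
  (\sum_(n <- s) w n) * (\sum_(n <- s) w n * (f n * g n)).

Fixpoint smooth (L : nat) (ps : seq nat) : seq nat :=
  if ps is p :: ps' then
    [seq (p ^ i * m)%N | i <- iota 0 L, m <- smooth L ps'] else [:: 1%N].

Lemma smooth_gt0 (L : nat) (ps : seq nat) (n : nat) :
  all prime ps -> n \in smooth L ps -> (0 < n)%N.
Proof.
elim: ps n => [|p ps IH] n /=; first by rewrite inE => _ /eqP->.
move=> /andP[pp pps] /allpairsP[[i m] /= [_ /(IH _ pps) m0 ->]].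
by rewrite muln_gt0 expn_gt0 prime_gt0.
Qed.

(** Since [w] is completely multiplicative, the exponent of [p] is independent of the cofactor. For
    a fixed exponent the induction hypothesis applies to the cofactor; the conditional sums [F f]
    and [F g] both decrease with the exponent, so Chebyshev's inequality treats the outer sum. *)
Lemma harris_smooth (R : realType) (w : nat -> R) (L : nat) (ps : seq nat) :
  (forall n, 0 <= w n) -> (forall m n, w (m * n)%N = w m * w n) -> w 1%N = 1 ->
  all prime ps -> harris w (smooth L ps).
Proof.
move=> w0 wM w1; elim: ps => [|p ps IH] /=.
  by move=> _ f g _ _; rewrite !big_seq1 w1 !mul1r.
move=> /andP[pp pps] f g fa ga; have {}IH := IH pps.
rewrite !big_allpairs_dep /=.
set s := smooth L ps in IH *.
pose F (h : nat -> R) i := \sum_(m <- s) w m * h (p ^ i * m)%N.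
have FE (h : nat -> R) : \sum_(i <- iota 0 L) \sum_(m <- s)
    w (p ^ i * m)%N * h (p ^ i * m)%N = \sum_(i <- iota 0 L) w (p ^ i)%N * F h i.
  apply: eq_bigr => i _; rewrite mulr_sumr; apply: eq_bigr => m _.
  by rewrite wM mulrA.
have FE1 : \sum_(i <- iota 0 L) \sum_(m <- s) w (p ^ i * m)%N
   = (\sum_(i <- iota 0 L) w (p ^ i)%N) * \sum_(m <- s) w m.
  rewrite mulr_suml; apply: eq_bigr => i _; rewrite mulr_sumr.
  by apply: eq_bigr => m _; rewrite wM.
rewrite (FE f) (FE g) (FE (fun n => f n * g n)) FE1.
have Fmono h : dvd_antitone h -> {homo F h : i j / (i <= j)%N >-> j <= i}.
  move=> ha i j ij; rewrite /F big_seq [leRHS]big_seq.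
  apply: ler_sum => m /(smooth_gt0 _ _ _ pps) m0; apply: ler_wpM2l => //.
  rewrite -(subnK ij) expnD -mulnA; apply: ha.
    by rewrite expn_gt0 prime_gt0.
  by rewrite muln_gt0 expn_gt0 prime_gt0.
apply: le_trans (chebyshev_sum _ _ _ (fun i => w (p ^ i)%N) (F f) (F g) _ _) _.
- by [].
- move=> i j; case/orP: (leq_total i j) => ij.
    by rewrite mulr_ge0 // subr_ge0; apply: Fmono.
  by rewrite mulr_le0 // subr_le0; apply: Fmono.
rewrite -mulrA; apply: ler_wpM2l; first exact: sumr_ge0.
rewrite mulr_sumr; apply: ler_sum => i _.
rewrite [leRHS]mulrCA; apply: ler_wpM2l => //.
have fia (h : nat -> R) : dvd_antitone h -> dvd_antitone (fun n => h (p ^ i * n)%N).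
  move=> ha k n k0 n0; rewrite mulnCA; apply: ha => //.
  by rewrite muln_gt0 expn_gt0 prime_gt0.
exact: (IH _ _ (fia f fa) (fia g ga)).
Qed.

Lemma coprime_smooth (L : nat) (ps : seq nat) (p n : nat) :
  all prime ps -> prime p -> p \notin ps -> n \in smooth L ps -> coprime p n.
Proof.
move=> + pp; elim: ps n => [|q ps IH] n /=.
  by rewrite inE => _ _ /eqP ->; rewrite coprimen1.
move=> /andP[qp pps]; rewrite inE negb_or => /andP[pq pnps].
move=> /allpairsP[[i m] /= [_ /(IH _ pps pnps) cpm ->]].
by rewrite coprimeMr cpm coprimeXr // prime_coprime // dvdn_prime2.
Qed.

Lemma smooth_uniq (L : nat) (ps : seq nat) :
  all prime ps -> uniq ps -> uniq (smooth L ps).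
Proof.
elim: ps => [|p ps IH] //= /andP[pp pps] /andP[pnps ups].
apply: allpairs_uniq; [exact: iota_uniq | exact: IH |].
move=> [i m] [j m'] /allpairsP[[i1 m1] /= [_ ms [-> ->]]].
move=> /allpairsP[[j1 m2] /= [_ ms' [-> ->]]] /= e {i m j m'}.
have lE k x : x \in smooth L ps -> logn p (p ^ k * x) = k.
  move=> xs; rewrite mulnC logn_Gauss ?pfactorK //.
  exact: coprime_smooth pps pp pnps xs.
have ij : i1 = j1 by rewrite -(lE i1 _ ms) e lE.
congr pair => //; move: e; rewrite ij => /eqP.
by rewrite eqn_pmul2l ?expn_gt0 ?prime_gt0 // => /eqP.
Qed.

Lemma mem_smooth (L : nat) (ps : seq nat) (n : nat) :
  all prime ps -> (0 < n)%N -> (n < L)%N ->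
  {subset primes n <= ps} -> n \in smooth L ps.
Proof.
elim: ps n => [|p ps IH] n /=.
  move=> _ n0 _ sn; rewrite inE; apply/eqP; move: (sn).
  case: (ltngtP n 1%N) => //; first by case: n n0 {sn}.
  move=> n1 _; have := sn (pdiv n).
  by rewrite mem_primes pdiv_prime // n0 pdiv_dvd => /(_ isT).
move=> /andP[pp pps] n0 nL sn; apply/allpairsP.
exists (logn p n, n`_p^')%N => /=; split.
- rewrite mem_iota add0n /=; apply: leq_trans nL.
  rewrite ltnS ltnW //; apply: leq_trans (ltn_expl _ (prime_gt1 pp)) _.
  by apply: dvdn_leq => //; exact: pfactor_dvdnn.
- apply: IH => //.
  + exact: leq_ltn_trans (dvdn_leq n0 (dvdn_part _ _)) nL.
  + move=> q; rewrite primes_part mem_filter => /andP[qp /sn].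
    by move: qp; rewrite !inE => /negPf ->.
- by rewrite -p_part partnC.
Qed.

Lemma ler_sum_uniq_sub (R : numDomainType) (I : eqType) (F : I -> R)
    (s t : seq I) :
  (forall i, 0 <= F i) -> uniq s -> uniq t -> {subset s <= t} ->
  \sum_(i <- s) F i <= \sum_(i <- t) F i.
Proof.
move=> F0 us ut st.
have /(perm_big _) -> : perm_eq s [seq i <- t | i \in s].
  apply: uniq_perm => //; first exact: filter_uniq.
  move=> i; rewrite mem_filter andb_idr //; exact: st.
rewrite big_filter big_mkcond /=; apply: ler_sum => i _.
by case: ifP.
Qed.

(** * Harmonic sums, Dirichlet weights and logarithmic bounds *)

Definition harmonic_sum {R : realType} (f : nat -> R) (n : nat) : R :=
  \sum_(1 <= k < n.+1) k%:R^-1 * f k.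

Definition dweight {R : realType} (s : R) (k : nat) : R := k%:R `^ (- (1 + s)).

Definition dsum {R : realType} (s : R) (f : nat -> R) (n : nat) : R :=
  \sum_(1 <= k < n.+1) dweight s k * f k.

(** The Dirichlet series of [f] at 1+s, hence zeta(1+s) for f = 1. The limit is genuine for 0 < s
    and unit-valued [f], by [is_cvg_dsum]. *)
Definition dseries {R : realType} (s : R) (f : nat -> R) : R := limn (dsum s f).

Definition unit_valued {R : realType} (f : nat -> R) := forall k, 0 <= f k <= 1.

Lemma dweight_ge0 (R : realType) (s : R) (k : nat) : 0 <= dweight s k.
Proof. exact: powR_ge0. Qed.

Lemma dweightM (R : realType) (s : R) (m n : nat) :
  dweight s (m * n)%N = dweight s m * dweight s n.
Proof. by rewrite /dweight natrM powRM. Qed.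

Lemma dweight1 (R : realType) (s : R) : dweight s 1 = 1.
Proof. by rewrite /dweight mulr1n powR1. Qed.

Lemma dweightE (R : realType) (s : R) (k : nat) : (0 < k)%N ->
  dweight s k = k%:R^-1 * k%:R `^ (- s).
Proof.
move=> k0; rewrite /dweight opprD powRD; last first.
  by apply/implyP => _; rewrite pnatr_eq0 -lt0n.
by rewrite powR_inv1.
Qed.

Lemma dweightD (R : realType) (s t : R) (k : nat) : (0 < k)%N ->
  dweight (s + t) k = dweight s k * k%:R `^ (- t).
Proof.
move=> k0; rewrite !dweightE // -mulrA -powRD; last first.
  by apply/implyP => _; rewrite pnatr_eq0 -lt0n.
by rewrite opprD.
Qed.

Lemma powRN_homo (R : realType) (s : R) (m n : nat) : 0 <= s ->
  (0 < m <= n)%N -> (n%:R : R) `^ (- s) <= m%:R `^ (- s).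
Proof.
move=> s0 /andP[m0 mn]; rewrite !powRN lef_pV2 ?posrE ?powR_gt0 ?ltr0n //.
  by apply: ge0_ler_powR; rewrite ?nnegrE ?ler_nat.
exact: leq_trans mn.
Qed.

Lemma powRN_le1 (R : realType) (s : R) (n : nat) : 0 <= s ->
  (n%:R : R) `^ (- s) <= 1.
Proof.
case: n => [|n] s0.
  (* At n = 0 the conventions 0^0 = 1 and 0^x = 0 for nonzero x decide. *)
  have [->|s_neq0] := eqVneq s 0; first by rewrite oppr0 powRr0.
  by rewrite powR0 ?oppr_eq0.
have := powRN_homo R s 1 n.+1 s0 isT; by rewrite mulr1n powR1.
Qed.

(** This bound and the next are ln(1+x) <= x, at x = -1/(n+1) and x = 1/n; summed, they enclose the
    harmonic sum. *)
Lemma ln_ratio_le (R : realType) (n : nat) : (0 < n)%N ->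
  ln (n%:R : R) - ln n.+1%:R <= - n.+1%:R^-1.
Proof.
move=> n0; rewrite -ln_div ?posrE ?ltr0n //.
have -> : n%:R / n.+1%:R = 1 + - n.+1%:R^-1 :> R.
  by rewrite -natr1; field; rewrite natr1 pnatr_eq0.
apply: le_ln1Dx; rewrite ltrN2 invf_lt1 ?ltr0n // ltr1n //.
Qed.

Lemma ln_ratio_ge (R : realType) (n : nat) : (0 < n)%N ->
  ln (n.+1%:R : R) - ln n%:R <= n%:R^-1.
Proof.
move=> n0; rewrite -ln_div ?posrE ?ltr0n //.
have -> : n.+1%:R / n%:R = 1 + n%:R^-1 :> R.
  by rewrite -natr1; field; rewrite pnatr_eq0 -lt0n.
apply: le_ln1Dx; apply: lt_le_trans (_ : 0 <= _); rewrite ?ltrN10 //.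
Qed.

Lemma ln_le_harmonic (R : realType) (n : nat) :
  ln (n.+1%:R : R) <= harmonic_sum (fun=> 1) n.
Proof.
rewrite /harmonic_sum /=; elim: n => [|n IH]; first by rewrite ln1 big_geq.
rewrite big_nat_recr //= mulr1.
rewrite -[leLHS](subrKC (ln n.+1%:R)); apply: lerD => //; exact: ln_ratio_ge.
Qed.

Lemma harmonic_le_ln (R : realType) (n : nat) :
  harmonic_sum (fun=> 1) n.+1 <= 1 + ln (n.+1%:R : R).
Proof.
rewrite /harmonic_sum /=; elim: n => [|n IH].
  by rewrite big_nat1 ln1 invr1 mulr1 addr0.
rewrite big_nat_recr //= mulr1.
rewrite -[ln n.+2%:R](subrKC (ln n.+1%:R)) addrA; apply: lerD => //.
by rewrite -[leLHS]opprK lerNl -opprB opprK ln_ratio_le.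
Qed.

Lemma harmonic_sum_homo (R : realType) (f : nat -> R) : (forall k, 0 <= f k) ->
  {homo harmonic_sum f : m n / (m <= n)%N >-> m <= n}.
Proof.
move=> f0 m n mn; rewrite /harmonic_sum [leRHS](big_cat_nat _ (n := m.+1)) //=.
by rewrite lerDl; apply: sumr_ge0 => k _; rewrite mulr_ge0 // invr_ge0.
Qed.

Lemma harmonic_sum_le (R : realType) (f g : nat -> R) (n : nat) :
  (forall k, (0 < k)%N -> f k <= g k) -> harmonic_sum f n <= harmonic_sum g n.
Proof.
move=> fg; apply: ler_sum_nat => k /andP[k0 _]; apply: ler_wpM2l => //.
exact: fg.
Qed.

(** * Dirichlet series and Harris' inequality in the limit *)

Section DirichletSeries.
Variable R : realType.
Implicit Types (f g : nat -> R) (s t : R).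

Lemma dsum_homo s f : unit_valued f ->
  {homo dsum s f : m n / (m <= n)%N >-> m <= n}.
Proof.
move=> f01 m n mn; rewrite /dsum [leRHS](big_cat_nat _ (n := m.+1)) //=.
rewrite lerDl; apply: sumr_ge0 => k _; rewrite mulr_ge0 ?dweight_ge0 //.
by case/andP: (f01 k).
Qed.

Lemma dsum_le s f g n : (forall k, (0 < k)%N -> f k <= g k) ->
  dsum s f n <= dsum s g n.
Proof.
move=> fg; apply: ler_sum_nat => k /andP[k0 _]; apply: ler_wpM2l.
  exact: dweight_ge0.
exact: fg.
Qed.

(** A discrete integral comparison: n^(-s) is (n+1)^(-s) times exp(s (ln(n+1) - ln n)), and the
    exponential is at least 1 + s/(n+1). *)
Lemma dweight_telescope s (n : nat) : 0 < s -> (0 < n)%N ->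
  dweight s n.+1 <= (n%:R `^ (- s) - n.+1%:R `^ (- s)) / s.
Proof.
move=> s0 n0; rewrite ler_pdivlMr // dweightE //.
have -> : n%:R `^ (- s) = n.+1%:R `^ (- s) *
    expR (- s * (ln (n%:R : R) - ln n.+1%:R)).
  rewrite /powR !pnatr_eq0 /= gtn_eqF // -expRD; congr expR; ring.
set y : R := n.+1%:R `^ (- s).
have y0 : 0 <= y by exact: powR_ge0.
rewrite -[X in _ - X]mulr1 -mulrBr mulrAC mulrC; apply: ler_wpM2l => //.
have := expR_ge1Dx (- s * (ln (n%:R : R) - ln n.+1%:R)).
have := ler_wpM2l (ltW s0) (ln_ratio_le R n n0).
set d := ln _ - ln _; set v := _^-1; rewrite mulNr mulrN => h1 h2.
rewrite lerBrDl; apply: le_trans h2; rewrite lerD2l mulrC; lra.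
Qed.

Lemma dsum1_le s n : 0 < s -> dsum s (fun=> 1) n <= 1 + s^-1.
Proof.
move=> s0; case: n => [|n].
  by rewrite /dsum big_geq // addr_ge0 // invr_ge0 ltW.
(* The induction needs the telescoped bound, which retains the term (n+1)^(-s). *)
apply: (@le_trans _ _ (1 + (1 - n.+1%:R `^ (- s)) / s)); last first.
  rewrite lerD2l -[leRHS]mul1r; apply: ler_wpM2r; first by rewrite invr_ge0 ltW.
  by rewrite gerBl powR_ge0.
elim: n => [|n IH].
  by rewrite /dsum big_nat1 dweight1 mulr1n powR1 subrr mul0r addr0 mulr1.
rewrite /dsum big_nat_recr //= mulr1.
apply: le_trans (lerD IH (dweight_telescope s n.+1 s0 isT)) _.
by rewrite -addrA -mulrDl lerD2l addrA subrK.
Qed.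

Lemma unit_valued1 : unit_valued (fun=> 1 : R).
Proof. by move=> k; rewrite ler01 lexx. Qed.

Lemma unit_valuedM f g : unit_valued f -> unit_valued g ->
  unit_valued (fun k => f k * g k).
Proof.
move=> f01 g01 k; case/andP: (f01 k) => f0 f1; case/andP: (g01 k) => g0 g1.
by rewrite mulr_ge0 //= mulr_ile1.
Qed.

Lemma is_cvg_dsum s f : 0 < s -> unit_valued f -> cvgn (dsum s f).
Proof.
move=> s0 f01; apply: nondecreasing_is_cvgn; first exact: dsum_homo.
exists (1 + s^-1) => _ [n _ <-]; apply: le_trans (dsum1_le s n s0).
by apply: dsum_le => k _; case/andP: (f01 k).
Qed.

Lemma dsum_le_dseries s f n : 0 < s -> unit_valued f ->
  dsum s f n <= dseries s f.
Proof.
move=> s0 f01; apply: nondecreasing_cvgn_le; first exact: dsum_homo.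
exact: is_cvg_dsum.
Qed.

Lemma dseries_le_bound s f (M : R) : 0 < s -> unit_valued f ->
  (forall n, dsum s f n <= M) -> dseries s f <= M.
Proof.
move=> s0 f01 fM; apply: limr_le; first exact: is_cvg_dsum.
exact: nearW.
Qed.

Lemma dseries1_gt0 s : 0 < s -> 0 < dseries s (fun=> 1).
Proof.
move=> s0; apply: lt_le_trans (dsum_le_dseries s _ 1%N s0 unit_valued1).
by rewrite /dsum big_nat1 dweight1 mulr1.
Qed.

(* Every positive integer up to [N] belongs to this list. *)
Definition smooth_below (N : nat) := smooth N.+1 [seq p <- iota 0 N.+1 | prime p].

(** Harris' inequality is known on the smooth grids, so the series must be reached along them. The
    grid contains 1, ..., N and has no repetitions, which puts its sum between [dsum s f N] and the
    whole series. *)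
Lemma cvg_smooth s f : 0 < s -> unit_valued f ->
  (fun N => \sum_(n <- smooth_below N) dweight s n * f n) @ \oo --> dseries s f.
Proof.
move=> s0 f01.
have F0 n : 0 <= dweight s n * f n.
  by rewrite mulr_ge0 ?dweight_ge0 //; case/andP: (f01 n).
have allp N : all prime [seq p <- iota 0 N.+1 | prime p] by exact: filter_all.
have uniqS N : uniq (smooth_below N).
  by apply: smooth_uniq => //; rewrite filter_uniq // iota_uniq.
apply: (@squeeze_cvgr _ _ _ _ (dsum s f) (fun=> dseries s f)); last 2 first.
- exact: is_cvg_dsum.
- exact: cvg_cst.
apply: nearW => N; apply/andP; split.
  apply: ler_sum_uniq_sub => //; first exact: iota_uniq.
  move=> n; rewrite mem_index_iota => /andP[n0 nN].
  apply: mem_smooth => // p; rewrite mem_primes mem_filter => /and3P[pp _].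
  move=> /(dvdn_leq n0) pn; rewrite pp mem_iota add0n.
  exact: leq_ltn_trans nN.
set M := \max_(n <- smooth_below N) n.
apply: le_trans (dsum_le_dseries s f M s0 f01).
apply: ler_sum_uniq_sub => //; first exact: iota_uniq.
move=> n nS; rewrite mem_index_iota (smooth_gt0 _ _ _ (allp N) nS) ltnS.
exact: leq_bigmax_seq.
Qed.

Lemma dseries_harris s f g : 0 < s -> unit_valued f -> unit_valued g ->
  dvd_antitone f -> dvd_antitone g ->
  dseries s f * dseries s g <=
  dseries s (fun=> 1) * dseries s (fun k => f k * g k).
Proof.
move=> s0 f01 g01 fa ga.
have cf := cvg_smooth s f s0 f01; have cg := cvg_smooth s g s0 g01.
have c1 := cvg_smooth s _ s0 unit_valued1.
have cfg := cvg_smooth s _ s0 (unit_valuedM f g f01 g01).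
apply: ler_cvg_to (cvgM cf cg) (cvgM c1 cfg) _.
apply: nearW => N /=.
under [X in _ <= X * _]eq_bigr do rewrite mulr1.
apply: harris_smooth => //; last exact: filter_all.
- exact: dweight_ge0.
- exact: dweightM.
- exact: dweight1.
Qed.

(* Harris' inequality for the antitone function k |-> k^(s-t), which turns the
   weight of exponent 1+s into that of exponent 1+t. *)
Lemma dseries_ratio_le s t f : 0 < s <= t -> unit_valued f -> dvd_antitone f ->
  dseries s f * dseries t (fun=> 1) <= dseries s (fun=> 1) * dseries t f.
Proof.
move=> /andP[s0 st] f01 fa.
pose g (k : nat) : R := k%:R `^ (- (t - s)).
have ts0 : 0 <= t - s by rewrite subr_ge0.
have g01 : unit_valued g by move=> k; rewrite powR_ge0 powRN_le1.
have ga : dvd_antitone g.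
  by move=> k n k0 n0; apply: powRN_homo => //; rewrite n0 leq_pmull.
have dE h : dseries t h = dseries s (fun k => h k * g k).
  congr (limn _); apply/funext => n; apply: eq_big_nat => k /andP[k0 _].
  by rewrite -[in LHS](subrKC s t) dweightD // -mulrA [g k * _]mulrC.
have := dseries_harris s f g s0 f01 g01 fa ga.
have -> : dseries t (fun=> 1) = dseries s g.
  by rewrite dE; congr dseries; apply/funext => k; rewrite mul1r.
by rewrite (dE f).
Qed.

End DirichletSeries.

(** * Logarithmic negligibility and its translation to Dirichlet series *)

(** Summation by parts: the sum is a combination of the partial sums of [c] with nonnegative
    coefficients of total [v 1], and each partial sum is at least -M. *)
Lemma abel_lower_bound (R : realDomainType) (c v : nat -> R) (M : R) (n : nat) :
  (forall n, - M <= \sum_(1 <= k < n.+1) c k) ->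
  (forall k, 0 <= v k) -> (forall k, (0 < k)%N -> v k.+1 <= v k) ->
  - (M * v 1%N) <= \sum_(1 <= k < n.+1) c k * v k.
Proof.
move=> cM v0 vn.
have M0 : 0 <= M by have := cM 0%N; rewrite big_geq // oppr_le0.
case: n => [|n]; first by rewrite [leRHS]big_geq // oppr_le0 mulr_ge0.
suff : (\sum_(1 <= k < n.+2) c k) * v n.+1 - M * (v 1%N - v n.+1) <=
    \sum_(1 <= k < n.+2) c k * v k.
  apply: le_trans; have := v0 n.+1; have := cM n.+1.
  set C := \sum_(_ <= _ < _) _; set x := v n.+1; set y := v 1%N; nra.
elim: n => [|n IH]; first by rewrite !big_nat1 subrr mulr0 subr0.
rewrite big_nat_recr //= [leRHS]big_nat_recr //=.
have := cM n.+1; have := vn n.+1 isT.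
move: IH; set C := \sum_(1 <= k < n.+2) c k; set D := \sum_(_ <= _ < _) _.
set x := v n.+1; set y := v 1%N; set z := v n.+2; set d := c n.+2; nra.
Qed.

Section LogarithmicallyNegligible.
Variable R : realType.
Implicit Types (f g : nat -> R) (s : R).

(* The sum over k <= n of f k / k is o(ln n), written without limits. *)
Definition log_negligible f := forall e : R, 0 < e ->
  exists M, forall n, harmonic_sum f n <= e * harmonic_sum (fun=> 1) n + M.

(** One exponent for each [e] is enough: for antitone [f], [dseries_ratio_le] extends the bound to
    all smaller exponents. *)
Definition dseries_negligible f := forall e : R, 0 < e ->
  exists2 s, 0 < s & dseries s f <= e * dseries s (fun=> 1).

(** With s = 1/ln n, every k <= n satisfies k^(-s) >= n^(-s) = 1 / [expR 1]. *)
Lemma harmonic_le_dseries f (n : nat) : (1 < n)%N -> unit_valued f ->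
  harmonic_sum f n <= expR 1 * dseries (ln (n%:R : R))^-1 f.
Proof.
move=> n1 f01.
have ln0 : 0 < ln (n%:R : R) by rewrite ln_gt0 // ltr1n.
have s0 : 0 < (ln (n%:R : R))^-1 by rewrite invr_gt0.
apply: le_trans (ler_wpM2l (expR_ge0 1) (dsum_le_dseries R _ f n s0 f01)).
rewrite /dsum mulr_sumr; apply: ler_sum_nat => k /andP[k0 kn].
rewrite dweightE // mulrA [expR 1 * _]mulrCA -!mulrA.
apply: ler_wpM2l; first by rewrite invr_ge0.
rewrite mulrA -[leLHS]mul1r; apply: ler_wpM2r; first by case/andP: (f01 k).
have : n%:R `^ (- (ln n%:R)^-1) <= k%:R `^ (- (ln n%:R)^-1) :> R.
  by apply: powRN_homo; rewrite ?(ltW s0) // k0.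
rewrite {1}/powR pnatr_eq0 gtn_eqF ?(ltnW n1) // mulNr mulVf ?gt_eqF //.
by rewrite expRN -[_^-1]mul1r ler_pdivrMr ?expR_gt0 // mulrC.
Qed.

(** At s = 1/ln n the series times [expR 1] dominates the harmonic sum, hence ln(n+1); so any large
    enough n serves. *)
Lemma dseries1_unbounded (M : R) : exists2 s, 0 < s & M <= dseries s (fun=> 1).
Proof.
pose n := (Num.truncn (expR (`|M| * expR 1))).+2.
have nM : expR (`|M| * expR 1) < n%:R.
  by apply: lt_trans (truncnS_gt _) _; rewrite ltr_nat.
have n1 : (1 < n)%N by [].
exists (ln (n%:R : R))^-1; first by rewrite invr_gt0 ln_gt0 // ltr1n.
have := harmonic_le_dseries _ n n1 (unit_valued1 R).
have : `|M| * expR 1 <= ln (n.+1%:R : R).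
  rewrite -[leLHS]expRK ler_ln ?posrE ?expR_gt0 ?ltr0n //.
  by apply: le_trans (ltW nM) _; rewrite ler_nat.
move=> /le_trans /(_ (ln_le_harmonic R n)) /le_trans h /h.
rewrite mulrC ler_pM2l ?expR_gt0 //; apply: le_trans; exact: ler_norm.
Qed.

(** Abel summation, against k^(-s), of the terms (e/2 - f k)/k, whose partial sums are at least -M.
    The exponent is chosen so that [M] is at most e/2 times zeta(1+s). *)
Lemma log_negligible_dseries f : unit_valued f ->
  log_negligible f -> dseries_negligible f.
Proof.
move=> f01 nf e e0; have e20 : 0 < e / 2 by lra.
have [M fM] := nf _ e20.
have [s s0 sM] := dseries1_unbounded (M / (e / 2)).
exists s => //; apply: dseries_le_bound => // n.
suff : dsum s f n <= e / 2 * dsum s (fun=> 1) n + M.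
  have := ler_wpM2l (ltW e20) (dsum_le_dseries R s _ n s0 (unit_valued1 R)).
  by move: sM; rewrite ler_pdivrMr //; lra.
pose c k := e / 2 * (k%:R^-1 * 1) - k%:R^-1 * f k.
pose v (k : nat) : R := k%:R `^ (- s).
have cM m : - M <= \sum_(1 <= k < m.+1) c k.
  rewrite sumrB -mulr_sumr; have := fM m; rewrite /harmonic_sum; lra.
have v0 k : 0 <= v k by exact: powR_ge0.
have vn k : (0 < k)%N -> v k.+1 <= v k.
  by move=> k0; apply: powRN_homo; rewrite ?ltW // k0 leqW.
have := abel_lower_bound _ c v M n cM v0 vn.
have -> : \sum_(1 <= k < n.+1) c k * v k =
    e / 2 * dsum s (fun=> 1) n - dsum s f n.
  rewrite mulr_sumr -sumrB; apply: eq_big_nat => k /andP[k0 _].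
  by rewrite dweightE // /c /v; ring.
by rewrite /v mulr1n powR1 mulr1; lra.
Qed.

(** For n beyond exp(1/s), t = 1/ln n is at most [s] and the bound passes from [s] to [t]. The
    factor [expR 1] lost in [harmonic_le_dseries] is offset by starting from [e / expR 1], and
    zeta(1+t) <= 1 + ln n. Smaller n go into the constant. *)
Lemma dseries_log_negligible f : unit_valued f -> dvd_antitone f ->
  dseries_negligible f -> log_negligible f.
Proof.
move=> f01 fa nf e e0.
have e'0 : 0 < e / expR 1 by rewrite divr_gt0 // expR_gt0.
have [s s0 sf] := nf _ e'0.
pose N := (Num.truncn (expR s^-1)).+2.
have H0 n : 0 <= harmonic_sum (fun=> 1 : R) n.
  by apply: sumr_ge0 => k _; rewrite mulr1 invr_ge0.
exists (e + harmonic_sum (fun=> 1) N) => n.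
case: (leqP n N) => nN.
  apply: (@le_trans _ _ (harmonic_sum (fun=> 1) N)).
    apply: le_trans (harmonic_sum_homo R _ (fun=> ler01) _ _ nN).
    by apply: harmonic_sum_le => k _; case/andP: (f01 k).
  rewrite addrA lerDr addr_ge0 ?(ltW e0) //.
  by rewrite mulr_ge0 // ltW.
have n1 : (1 < n)%N by apply: leq_trans nN.
apply: le_trans (harmonic_le_dseries f n n1 f01) _.
set t := (ln (n%:R : R))^-1.
have ln0 : 0 < ln (n%:R : R) by rewrite ln_gt0 // ltr1n.
have t0 : 0 < t by rewrite invr_gt0.
have ts : t <= s.
  rewrite -[s]invrK lef_pV2 ?posrE ?invr_gt0 //.
  rewrite -[leLHS]expRK ler_ln ?posrE ?expR_gt0 ?ltr0n ?(ltnW n1) //.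
  apply: le_trans (ltW (truncnS_gt _)) _; rewrite ler_nat.
  by apply: leq_trans nN; rewrite ltnS leqW.
have tf : dseries t f <= e / expR 1 * dseries t (fun=> 1).
  have := dseries_ratio_le R t s f; rewrite t0 ts => /(_ isT f01 fa) h.
  have Z0 := dseries1_gt0 R s s0.
  rewrite -(ler_pM2r Z0); apply: le_trans h _.
  by rewrite mulrAC mulrC; apply: ler_wpM2r => //; exact/ltW/dseries1_gt0.
have tZ : dseries t (fun=> 1) <= 1 + ln n%:R.
  have -> : ln n%:R = t^-1 by rewrite invrK.
  apply: dseries_le_bound => //; first exact: unit_valued1.
  by move=> m; exact: dsum1_le.
apply: le_trans (ler_wpM2l (expR_ge0 1) tf) _.
rewrite mulrA mulrCA divff ?gt_eqF ?expR_gt0 // mulr1.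
apply: le_trans (ler_wpM2l (ltW e0) tZ) _.
rewrite mulrDr mulr1 [leRHS]addrA [_ + e]addrC; apply: ler_wpDr => //.
rewrite lerD2l; apply: ler_wpM2l; first exact: ltW.
apply: le_trans (ln_le_harmonic R n).
by rewrite ler_ln ?posrE ?ltr0n ?ler_nat ?(ltnW n1) //.
Qed.

(** If both factors failed, with constants [d] and [e] valid at every exponent, an exponent that
    suits the product for d * e would violate Harris' inequality. *)
Lemma dseries_negligibleM f g : unit_valued f -> unit_valued g ->
  dvd_antitone f -> dvd_antitone g ->
  dseries_negligible (fun k => f k * g k) ->
  dseries_negligible f \/ dseries_negligible g.
Proof.
move=> f01 g01 fa ga nfg.
have [|nf] := pselect (dseries_negligible f); first by left.
right => e e0; apply: contrapT => ne; apply: nf => d d0; apply: contrapT => nd.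
have [s s0 sfg] := nfg _ (mulr_gt0 d0 e0).
have Z0 := dseries1_gt0 R s s0.
have sf : d * dseries s (fun=> 1) < dseries s f.
  by rewrite ltNge; apply/negP => h; apply: nd; exists s.
have sg : e * dseries s (fun=> 1) < dseries s g.
  by rewrite ltNge; apply/negP => h; apply: ne; exists s.
have := dseries_harris R s f g s0 f01 g01 fa ga.
apply/negP; rewrite -ltNge.
apply: le_lt_trans (ler_wpM2l (ltW Z0) sfg) _.
apply: le_lt_trans (_ : _ <= d * dseries s (fun=> 1) * (e * dseries s (fun=> 1)))
  _; first by rewrite le_eqVlt; apply/orP; left; apply/eqP; ring.
by apply: ltr_pM => //; rewrite ?mulr_ge0 // ltW.
Qed.

Lemma log_negligible_le f g : (forall k, (0 < k)%N -> f k <= g k) ->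
  log_negligible g -> log_negligible f.
Proof.
move=> fg ng e /ng[M gM]; exists M => n.
exact: le_trans (harmonic_sum_le R f g n fg) (gM n).
Qed.

(** For indicators of avoiding two sets of multiples, this says that a union of two non-negligible
    obstacles stays non-negligible. *)
Lemma log_negligibleM f g : unit_valued f -> unit_valued g ->
  dvd_antitone f -> dvd_antitone g ->
  log_negligible (fun k => f k * g k) -> log_negligible f \/ log_negligible g.
Proof.
move=> f01 g01 fa ga /(log_negligible_dseries _ (unit_valuedM R f g f01 g01)).
move=> /(dseries_negligibleM _ _ f01 g01 fa ga)[h|h]; [left|right];
  exact: dseries_log_negligible.
Qed.

Lemma log_negligible1 : ~ log_negligible (fun=> 1).
Proof.
move=> /(log_negligible_dseries _ (unit_valued1 R)) /(_ 2^-1).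
rewrite invr_gt0 ltr0n => /(_ isT)[s s0].
have := dseries1_gt0 R s s0; lra.
Qed.

Lemma log_negligible_prod (I : eqType) (F : I -> nat -> R) (r : seq I) :
  (forall i, unit_valued (F i)) -> (forall i, dvd_antitone (F i)) ->
  log_negligible (fun k => \prod_(i <- r) F i k) ->
  exists2 i, i \in r & log_negligible (F i).
Proof.
move=> F01 Fa.
have P01 q : unit_valued (fun k => \prod_(i <- q) F i k).
  move=> k; apply/andP; split; first by apply: prodr_ge0 => i _; case/andP: (F01 i k).
  by apply: prodr_ile1 => i _; exact: F01.
elim: r => [|i r IH].
  by under eq_fun do rewrite big_nil; move=> /log_negligible1.
under eq_fun do rewrite big_cons.
have Pa : dvd_antitone (fun k => \prod_(i <- r) F i k).
  move=> k n k0 n0; apply: ler_prod => j _; rewrite Fa // andbT.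
  by case/andP: (F01 j (k * n)%N).
move=> /(log_negligibleM _ _ (F01 i) (P01 r) (Fa i) Pa)[h|/IH[j jr h]].
  by exists i; rewrite ?mem_head.
by exists j; rewrite // inE jr orbT.
Qed.

Lemma harmonic_sum_dilate f (g n : nat) : (0 < g)%N -> (forall k, 0 <= f k) ->
  \sum_(1 <= k < n.+1 | (g %| k)%N) k%:R^-1 * f (k %/ g)%N <=
  g%:R^-1 * harmonic_sum f n.
Proof.
move=> g0 f0; rewrite -big_filter; set s := [seq k <- _ | _].
have sE k : k \in s -> exists2 j, (0 < j <= n)%N & k = (j * g)%N.
  rewrite mem_filter mem_index_iota => /andP[/dvdnP[j ->] /andP[]].
  rewrite muln_gt0 g0 andbT ltnS => j0 jn; exists j => //.
  by rewrite j0 (leq_trans _ jn) // leq_pmulr.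
have -> : \sum_(k <- s) k%:R^-1 * f (k %/ g)%N =
    g%:R^-1 * \sum_(j <- [seq (k %/ g)%N | k <- s]) j%:R^-1 * f j.
  rewrite big_map mulr_sumr !big_seq; apply: eq_bigr => k /sE[j _ ->].
  by rewrite mulnK // natrM invfM; ring.
apply: ler_wpM2l; first by rewrite invr_ge0.
apply: ler_sum_uniq_sub.
- by move=> k; rewrite mulr_ge0 // invr_ge0.
- rewrite map_inj_in_uniq ?filter_uniq ?iota_uniq //.
  move=> _ _ /sE[i _ ->] /sE[j _ ->]; rewrite !mulnK //; congruence.
- exact: iota_uniq.
- move=> _ /mapP[_ /sE[j jn ->] ->]; rewrite mulnK // mem_index_iota ltnS //.
Qed.

(** Multiples of [a] carry at most 1/a <= 1/2 of the harmonic sum, so the others carry at least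
    half; were they negligible, the constant 1 would be too. *)
Lemma log_negligible_ndvd (a : nat) : (1 < a)%N ->
  ~ log_negligible (fun k => (~~ (a %| k)%N)%:R).
Proof.
move=> a1 na; apply: log_negligible1 => e e0.
have [] := na (e / 2); first by lra.
move=> M aM; exists (2 * M) => n.
have a2 : a%:R^-1 <= 2^-1 :> R by rewrite lef_pV2 ?posrE ?ltr0n ?ler_nat ?(ltnW a1).
have H0 : 0 <= harmonic_sum (fun=> 1 : R) n.
  by apply: sumr_ge0 => k _; rewrite mulr1 invr_ge0.
have := aM n; have := harmonic_sum_dilate (fun=> 1) a n (ltnW a1) (fun=> ler01).
have : harmonic_sum (fun=> 1) n =
    harmonic_sum (fun k => (~~ (a %| k)%N)%:R) n +
    \sum_(1 <= k < n.+1 | (a %| k)%N) k%:R^-1 * 1 :> R.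
  rewrite /harmonic_sum [X in _ + X]big_mkcond -big_split /=.
  apply: eq_bigr => k _; case: ifP => _ /=; ring.
set H := harmonic_sum (fun=> 1) n; set X := harmonic_sum _ _.
set Y := \sum_(_ <= _ < _ | _) _.
have := ler_wpM2r H0 a2; rewrite -/H; lra.
Qed.

End LogarithmicallyNegligible.

(** * Behrend sets, taut sets and divisibility *)

Lemma mem_multiplesP (S : set nat) (k : nat) :
  reflect (exists2 a, S a & (a %| k)%N) ((k%:Z : int) \in multiples S).
Proof.
apply: (iffP idP); rewrite in_setE.
  by case=> a Sa /=; rewrite dvdzE !absz_nat; exists a.
by case=> a Sa ak; exists a => //=; rewrite dvdzE !absz_nat.
Qed.

Section Taut.
Variable R : realType.
Implicit Types (S A E : set nat).

Lemma ler_bool (b c : bool) : (b -> c) -> b%:R <= c%:R :> R.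
Proof. by rewrite ler_nat; case: b => // /(_ isT) ->. Qed.

Definition nonmultiple S (k : nat) : R := ((k%:Z : int) \notin multiples S)%:R.

Lemma nonmultiple_unit_valued S : unit_valued (nonmultiple S).
Proof. by move=> k; rewrite /nonmultiple; case: (_ \notin _); rewrite ?lexx ?ler01. Qed.

Lemma nonmultiple_antitone S : dvd_antitone (nonmultiple S).
Proof.
move=> k n k0 n0; apply: ler_bool; apply: contra => /mem_multiplesP[a Sa an].
by apply/mem_multiplesP; exists a => //; exact: dvdn_mull.
Qed.

Lemma harmonic_sum_indicator (P : pred nat) n :
  harmonic_sum (fun k => (P k)%:R) n =
  \sum_(1 <= k < n.+1 | P k) k%:R^-1 :> R.
Proof.
rewrite [RHS]big_mkcond; apply: eq_bigr => k _.
by case: (P k); rewrite (mulr1, mulr0).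
Qed.

Lemma log_negligible_ratio (f : nat -> R) (e : R) : log_negligible R f -> 0 < e ->
  exists N, forall n, (N <= n)%N -> 0 < ln (n%:R : R) /\
    harmonic_sum f n <= e * ln n%:R.
Proof.
move=> nf e0; have [|M fM] := nf (e / 2); first by lra.
(* Once ln n >= b, the constant M + e/2 is at most (e/2) ln n; the extra 1 below keeps ln n
   positive. *)
pose b := `|2 * (M + e / 2) / e|.
exists (Num.truncn (expR (b + 1))).+1 => n Nn.
have n0 : (0 < n)%N by exact: leq_trans Nn.
have lnb : b + 1 <= ln n%:R.
  rewrite -[leLHS]expRK ler_ln ?posrE ?expR_gt0 ?ltr0n //.
  by apply: le_trans (ltW (truncnS_gt _)) _; rewrite ler_nat.
have b0 : 0 <= b by exact: normr_ge0.
split; first by lra.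
apply: le_trans (fM n) _.
have := harmonic_le_ln R n.-1; rewrite prednK // => H.
have : 2 * (M + e / 2) <= e * ln n%:R.
  rewrite [leRHS]mulrC -ler_pdivrMr //.
  by apply: le_trans (ler_norm _) _; rewrite -/b; lra.
have := ler_wpM2l (ltW e0) H; lra.
Qed.

Lemma behrend_log_negligible A : behrend R A -> log_negligible R (nonmultiple A).
Proof.
pose u (n : nat) : R :=
  (\sum_(1 <= k < n.+1 | (k%:Z : int) \in multiples A) k%:R^-1) / ln n%:R.
move=> [_ dA] e e0.
have : u @ \oo --> (1 : R).
  (* A divergent sequence has the default limit 0, so the value 1 forces convergence. *)
  rewrite -dA; apply: contrapT => /dvgP p.
  by have /eqP := dA; rewrite [log_density _ _]p eq_sym oner_eq0.
move=> /cvgrPdist_le /(_ e e0)[N _ uN].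
pose N' := N.+2.
exists (harmonic_sum (fun=> 1) N' + 1) => n.
have H0 m : 0 <= harmonic_sum (fun=> 1 : R) m.
  by apply: sumr_ge0 => k _; rewrite mulr1 invr_ge0.
have [nN|nN] := leqP n N'.
  apply: (@le_trans _ _ (harmonic_sum (fun=> 1) N')).
    apply: le_trans (harmonic_sum_homo R _ (fun=> ler01) _ _ nN).
    apply: harmonic_sum_le => k _.
    by case/andP: (nonmultiple_unit_valued A k).
  by have := mulr_ge0 (ltW e0) (H0 n); lra.
have n1 : (1 < n)%N by apply: leq_trans nN.
have ln0 : 0 < ln (n%:R : R) by rewrite ln_gt0 // ltr1n.
have /= := uN n; rewrite -/(u n) => /(_ _) un.
have {}un : `|1 - u n| <= e by apply: un; apply: ltnW; apply: ltnW; exact: ltnW.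
have HE : harmonic_sum (fun=> 1) n = harmonic_sum (nonmultiple A) n + u n * ln n%:R.
  rewrite /u divfK ?gt_eqF // -harmonic_sum_indicator -big_split /=.
  apply: eq_bigr => k _; rewrite /nonmultiple -mulrDr; congr (_ * _).
  by case: (_ \in _); rewrite /= ?add0r ?addr0.
have := harmonic_le_ln R n.-1; rewrite prednK ?(ltnW n1) // HE => Hl.
have : ln n%:R <= harmonic_sum (fun=> 1 : R) n.
  apply: le_trans (ln_le_harmonic R n).
  by rewrite ler_ln ?posrE ?ltr0n ?ler_nat ?(ltnW n1).
move=> /(ler_wpM2l (ltW e0)).
have := ler_wpM2r (ltW ln0) (le_trans (ler_norm _) un).
rewrite -HE; have := H0 N'; move: Hl; rewrite mulrBl mul1r.
lra.
Qed.

(* [u] and [v] need not converge: two divergent sequences share the default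
   value of [limn], so no appeal to the Davenport-Erdos theorem is needed. *)
Lemma limn_eq (u v : R^nat) : (u \- v) @ \oo --> (0 : R) -> limn u = limn v.
Proof.
have main (a b : R^nat) : (a \- b) @ \oo --> (0 : R) -> cvgn a -> limn b = limn a.
  move=> ab ca; apply/cvg_lim => //.
  have -> : b = a \- (a \- b) by apply/funext => n /=; rewrite subKr.
  by rewrite -[limn a]subr0; apply: cvgB.
move=> uv; have vu : (v \- u) @ \oo --> (0 : R).
  rewrite -oppr0; have -> : v \- u = - (u \- v).
    by apply/funext => n; rewrite /= !fctE opprB.
  exact: cvgN.
have [cu|du] := pselect (cvgn u); first by rewrite (main _ _ uv).
have [cv|dv] := pselect (cvgn v); first by rewrite (main _ _ vu).
by rewrite (dvgP du) (dvgP dv).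
Qed.

(* If [nonmultiple S] is negligible, so is [nonmultiple (S `\ a)] for any a in S;
   hence removing g * a from E does not change the logarithmic density. *)
Lemma taut_not_log_negligible E S (g : nat) : taut R E -> E `<=` posn ->
  (forall a, S a -> E (g * a)%N /\ a <> 1%N) -> ~ log_negligible R (nonmultiple S).
Proof.
move=> tE Epos SE nS.
have [[a Sa]|S0] := pselect (S !=set0); last first.
  apply: (log_negligible1 R); apply: log_negligible_le nS => k _.
  rewrite /nonmultiple; case: (boolP (_ \in _)) => //= /mem_multiplesP[a Sa _].
  by case: S0; exists a.
have [Ega a1] := SE _ Sa.
have : (0 < g * a)%N by exact: Epos.
rewrite muln_gt0 => /andP[g0 a0].
have {}a1 : (1 < a)%N by case: a a0 a1 {Sa Ega} => [|[|]].
(* Avoiding both [a] and the rest of [S] means avoiding [S]. One factor must be negligible, and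
   non-divisibility by a > 1 is not. *)
have : log_negligible R (fun k => nonmultiple (S `\ a) k * (~~ (a %| k)%N)%:R).
  apply: log_negligible_le nS => k _; rewrite /nonmultiple.
  case: (boolP (_ \in multiples S)) => [|_] /=; last first.
    by rewrite mulr_ile1 ?ler0n ?lern1 ?leq_b1.
  move=> /mem_multiplesP[b Sb bk].
  have [<-|/eqP ba] := eqVneq b a; first by rewrite bk mulr0.
  suff -> : (k%:Z : int) \in multiples (S `\ a) by rewrite mul0r.
  by apply/mem_multiplesP; exists b.
move=> /log_negligibleM[].
- exact: nonmultiple_unit_valued.
- by move=> k; rewrite ler0n lern1 leq_b1.
- exact: nonmultiple_antitone.
- move=> k n k0 n0; apply: ler_bool.
  by apply: contra => /dvdn_mull ->.
- move=> nSa; have := tE _ Ega; rewrite lt_neqAle => /andP[/eqP + _]; apply.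
  apply/esym/limn_eq; apply/cvgrPdist_le => e e0.
  have [N fN] := log_negligible_ratio _ _ nSa e0.
  exists N => // n /= /fN[ln0 fn].
  rewrite sub0r normrN -mulrBl normrM [`|_^-1|]gtr0_norm ?invr_gt0 //.
  rewrite ler_pdivrMr //.
  set M1 := multiples E; set M2 := multiples _.
  have M21 k : (k%:Z : int) \in M2 -> (k%:Z : int) \in M1.
    by move=> /mem_multiplesP[b [Eb _] bk]; apply/mem_multiplesP; exists b.
  have -> : \sum_(1 <= k < n.+1 | (k%:Z : int) \in M1) (k%:R^-1 : R)
      - \sum_(1 <= k < n.+1 | (k%:Z : int) \in M2) k%:R^-1 =
      \sum_(1 <= k < n.+1 | ((k%:Z : int) \in M1) && ((k%:Z : int) \notin M2))
         k%:R^-1.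
    rewrite [X in X - _](bigID (fun k => (k%:Z : int) \in M2)) /=.
    rewrite (_ : \sum_(1 <= k < n.+1 | _ && ((k%:Z : int) \in M2)) _ =
       \sum_(1 <= k < n.+1 | (k%:Z : int) \in M2) k%:R^-1).
      by rewrite addrAC subrr add0r.
    by apply: eq_bigl => k; apply: andb_idl; exact: M21.
  rewrite ger0_norm; last by apply: sumr_ge0 => k _; rewrite invr_ge0.
  apply: le_trans fn.
  have nn0 k : 0 <= nonmultiple (S `\ a) k.
    by case/andP: (nonmultiple_unit_valued (S `\ a) k).
  apply: (@le_trans _ _ (g%:R^-1 * harmonic_sum (nonmultiple (S `\ a)) n)); last first.
    rewrite -[leRHS]mul1r; apply: ler_wpM2r.
      by apply: sumr_ge0 => k _; rewrite mulr_ge0 // invr_ge0.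
    by rewrite invf_le1 ?ltr0n // ler1n.
  apply: le_trans (harmonic_sum_dilate R _ g n g0 nn0).
  rewrite big_mkcond [leRHS]big_mkcond /=; apply: ler_sum => k _.
  (* A [k] lost on removing g * a is a multiple of g * a, and k / g avoids the rest of [S]: a
     divisor [c] there would make g * c another element of [E] dividing [k]. *)
  case: ifP => [/andP[/mem_multiplesP[b Eb bk] kM2]|_]; last first.
    by case: ifP => // _; rewrite mulr_ge0 // invr_ge0.
  have bE : b = (g * a)%N.
    apply: contrapT => ba; move/negP: kM2; apply; apply/mem_multiplesP.
    by exists b.
  have gk : (g %| k)%N by apply: dvdn_trans bk; rewrite bE dvdn_mulr.
  rewrite gk /nonmultiple (_ : (_ \notin _) = true) ?mulr1 //.
  apply/negP => /mem_multiplesP[c [Sc ca] ck]; move/negP: kM2; apply.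
  apply/mem_multiplesP; exists (g * c)%N; last by rewrite -(divnK gk) mulnC dvdn_pmul2r.
  split; first by case: (SE _ Sc).
  by move=> /= /eqP; rewrite eqn_pmul2l // => /eqP.
- exact: log_negligible_ndvd.
Qed.

(** Otherwise [d] covers all multiples of [e], and removing [e] leaves the set of multiples
    unchanged. *)
Lemma taut_primitive E (d e : nat) : taut R E -> E d -> E e -> (d %| e)%N -> d = e.
Proof.
move=> tE Ed Ee de; apply: contrapT => dne.
suff ME : multiples (E `\ e) = multiples E by have := tE _ Ee; rewrite ME ltxx.
apply/seteqP; split=> z [b].
  by move=> [Eb _] bz; exists b.
move=> Eb /= bz; have [be|/eqP be] := eqVneq b e; last by exists b.
exists d => //=; apply: dvdz_trans bz; rewrite be dvdzE !absz_nat //.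
Qed.

Lemma taut_divisor E A (c : nat) : taut R E -> E `<=` posn -> (0 < c)%N ->
  behrend R A -> (forall a, A a -> exists2 e, E e & (e %| c * a)%N) ->
  exists2 e, E e & (e %| c)%N.
Proof.
move=> tE Epos c0 bA cA; apply: contrapT => nec.
(* [E] is sorted by the gcd with [c], each class being divided by that gcd. *)
pose S (g : nat) : set nat := [set a | E (g * a)%N /\ gcdn (g * a) c = g].
(* k |-> nonmultiple E (c * k) is negligible, and it is the product over g | c
   of the [nonmultiple (S g)], so one factor is negligible. *)
have [g gc nS] : exists2 g, g \in divisors c & log_negligible R (nonmultiple (S g)).
  apply: log_negligible_prod.
  - by move=> g; exact: nonmultiple_unit_valued.
  - by move=> g; exact: nonmultiple_antitone.
  apply: log_negligible_le (behrend_log_negligible _ bA) => k _.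
  rewrite /nonmultiple; case: (boolP (_ \in multiples A)) => /=; last first.
    move=> _; apply: prodr_ile1 => g _; exact: (nonmultiple_unit_valued (S g) k).
  move=> /mem_multiplesP[a Aa ak].
  have [e Ee eca] := cA _ Aa.
  have e0 : (0 < e)%N by exact: Epos.
  have eck : (e %| c * k)%N by apply: dvdn_trans eca _; rewrite dvdn_pmul2l.
  have gd : gcdn e c \in divisors c by rewrite -dvdn_divisors // dvdn_gcdr.
  rewrite (bigD1_seq _ gd (divisors_uniq c)) /=.
  suff -> : (k%:Z : int) \in multiples (S (gcdn e c)) by rewrite mul0r.
  have g0 : (0 < gcdn e c)%N by rewrite gcdn_gt0 e0.
  apply/mem_multiplesP; exists (e %/ gcdn e c)%N.
    by rewrite /S /= muln_divA ?dvdn_gcdl // mulKn.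
  (* As [e] divides both e * k and c * k, it divides their gcd, which is k times gcd(e, c). *)
  rewrite -(dvdn_pmul2l g0) muln_divA ?dvdn_gcdl // mulKn // mulnC.
  by rewrite muln_gcdr dvdn_gcd dvdn_mull // mulnC.
(* The value 1 is not in [S g], since otherwise [g] itself would be an element of [E] dividing
   [c]. *)
apply: (taut_not_log_negligible E (S g) g) nS => // a [Ega ga]; split => // a1.
apply: nec; exists (g * a)%N => //; rewrite a1 muln1.
by rewrite dvdn_divisors.
Qed.

End Taut.

(** * Oscillating frequencies and periodic sets of multiples *)

Lemma oscillation (R : realType) (u : R^nat) :
  (forall n, 0 <= u n <= 1) -> ~ cvgn u ->
  exists a b, [/\ a < b, forall N, exists2 n, (N <= n)%N & u n < a &
    forall N, exists2 n, (N <= n)%N & b < u n].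
Proof.
move=> u01 ncu.
(* The supremum of [D] is the limit superior of [u]. Without convergence to it, [u] is infinitely
   often at distance above some [e]; being eventually at most sup D + e, it then lies below sup D -
   e. *)
pose D := [set x : R | forall N, exists2 n, (N <= n)%N & x < u n].
have supD : has_sup D.
  split; first by exists (-1) => N; exists N => //; case/andP: (u01 N); lra.
  exists 1 => x /(_ 0%N)[n _ xu]; case/andP: (u01 n); lra.
have nuS : ~ (u @ \oo --> (sup D : R)).
  by move=> uS; apply: ncu; apply/cvg_ex; exists (sup D).
have [e e0 ue] : exists2 e : R, 0 < e &
    forall N, exists2 n, (N <= n)%N & e < `|sup D - u n|.
  apply: contrapT => H; apply: nuS; apply/cvgrPdist_le => e e0.
  apply: contrapT => He; apply: H; exists e => // N.
  apply: contrapT => HN; apply: He; exists N => // n /= Nn.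
  by rewrite leNgt; apply/negP => h; apply: HN; exists n.
have e20 : 0 < e / 2 by lra.
have [x Dx xS] := sup_adherent e20 supD.
exists (sup D - e), (sup D - e / 2); split; first by lra.
- move=> N; have : ~ D (sup D + e).
    by move=> /(ub_le_sup supD.2); lra.
  rewrite /D /= -existsNE => -[N' N'u].
  have [n Nn en] := ue (maxn N N').
  exists n; first by apply: leq_trans Nn; exact: leq_maxl.
  have : u n <= sup D + e.
    rewrite leNgt; apply/negP => h; apply: N'u; exists n => //.
    by apply: leq_trans Nn; exact: leq_maxr.
  by move: en; rewrite lter_normr; lra.
- move=> N; have [n Nn xn] := Dx N; exists n => //; lra.
Qed.

Section Counting.
Variable P : pred nat.

Definition count_upto (n : nat) : nat := \sum_(1 <= k < n.+1 | P k) 1.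

Lemma count_upto0 : count_upto 0 = 0%N.
Proof. by rewrite /count_upto big_geq. Qed.

Lemma count_uptoS n : count_upto n.+1 = (count_upto n + P n.+1)%N.
Proof.
rewrite /count_upto big_mkcond big_nat_recr //= -big_mkcond.
by case: (P n.+1).
Qed.

Lemma count_upto_le n : (count_upto n <= n)%N.
Proof.
elim: n => [|n IH]; first by rewrite count_upto0.
by rewrite count_uptoS -addn1 leq_add // leq_b1.
Qed.

Lemma count_upto_periodic (Q q r : nat) : (forall k, P (k + Q)%N = P k) ->
  count_upto (q * Q + r) = (q * count_upto Q + count_upto r)%N.
Proof.
move=> PQ.
have cQ n : count_upto (Q + n) = (count_upto Q + count_upto n)%N.
  elim: n => [|n IH]; first by rewrite addn0 count_upto0 addn0.
  by rewrite addnS !count_uptoS IH -[(Q + n).+1]addnS [(Q + n.+1)%N]addnC PQ addnA.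
elim: q => [|q IH]; first by rewrite !mul0n !add0n.
by rewrite !mulSn -!addnA cQ IH.
Qed.

End Counting.

Lemma freq_itv (R : realType) (A : set int) (n : nat) : 0 <= freq R A n <= 1.
Proof.
rewrite /freq divr_ge0 //=; case: n => [|n]; first by rewrite invr0 mulr0.
rewrite ler_pdivrMr ?ltr0n // mul1r ler_nat.
exact: (count_upto_le (fun k => (k%:Z : int) \in A)).
Qed.

(** Write n = qQ + r. With C and d the counts up to Q and r, the count up to n is qC + d, so
    cross-multiplying leaves dQ - Cr, a difference of two numbers in [0, Q^2]. *)
Lemma freq_periodic_dist (R : realType) (A : set int) (Q n : nat) :
  (0 < Q)%N -> (0 < n)%N ->
  (forall k : nat, ((k + Q)%:Z \in A) = (k%:Z \in A)) ->
  `|freq R A n - freq R A Q| <= Q%:R / n%:R.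
Proof.
move=> Q0 n0 AQ.
pose P := [pred k : nat | (k%:Z : int) \in A].
have cE m : freq R A m = (count_upto P m)%:R / m%:R by [].
rewrite !cE.
have := count_upto_periodic P Q (n %/ Q) (n %% Q) AQ.
rewrite -divn_eq => cn.
have rQ := ltn_pmod n Q0; have cr := count_upto_le P (n %% Q).
have CQ := count_upto_le P Q.
have nE := divn_eq n Q.
set c := count_upto P n in cn *; set C := count_upto P Q in cn CQ *.
have [Q0' n0'] : 0 < Q%:R :> R /\ 0 < n%:R :> R by rewrite !ltr0n.
have -> : c%:R / n%:R - C%:R / Q%:R = (c%:R * Q%:R - C%:R * n%:R) / (n%:R * Q%:R) :> R.
  by field; rewrite !gt_eqF.
rewrite normrM [`|_^-1|]gtr0_norm ?invr_gt0 ?mulr_gt0 //.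
rewrite invfM mulrA mulrAC; apply: ler_wpM2r; first by rewrite invr_ge0 ltW.
rewrite ler_pdivrMr // ler_norml.
set r := (n %% Q)%N in cn rQ cr nE *; set q := (n %/ Q)%N in cn nE *.
set d := count_upto P r in cn cr *.
rewrite cn {1 2}nE !natrD !natrM.
have : (d * Q <= Q * Q)%N by rewrite leq_mul2r; apply/orP; right; lia.
have : (C * r <= Q * Q)%N by apply: leq_mul; lia.
rewrite -!(ler_nat R) !natrM.
have d0 : 0 <= d%:R * Q%:R :> R by rewrite mulr_ge0.
have r0 : 0 <= C%:R * r%:R :> R by rewrite mulr_ge0.
move=> h1 h2; apply/andP; split; nra.
Qed.

Lemma multiples_periodic (F : set nat) (m : nat) : F `<=` [set k | 0 < k < m]%N ->
  forall k : nat, ((k + m`!)%:Z \in multiples F) = (k%:Z \in multiples F).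
Proof.
move=> Fm k; apply/mem_multiplesP/mem_multiplesP => -[b Fb bk]; exists b => //;
  have /andP[b0 bm] := Fm _ Fb; have bf : (b %| m`!)%N by
    rewrite dvdn_fact // b0 ltnW.
- by rewrite -(dvdn_addl k bf).
- by rewrite dvdn_addl.
Qed.

(** The finite part is below [a] at some large n because [E] is; by periodicity its frequencies at
    large arguments are within (b - a)/2 of the one at a full period, hence below [b]. *)
Lemma freq_multiples_below (R : realType) (E : set nat) (a b : R) (m : nat) :
  a < b -> (forall N, exists2 n, (N <= n)%N & freq R (multiples E) n < a) ->
  exists N, forall n, (N <= n)%N ->
    freq R (multiples (E `&` [set k | 0 < k < m]%N)) n < b.
Proof.
move=> ab Ea; set F := E `&` _.
have Fper := multiples_periodic F m (@subIsetr _ _ _).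
have Q0 := fact_gt0 m; set Q := m`! in Fper Q0.
have FE n : freq R (multiples F) n <= freq R (multiples E) n.
  rewrite /freq; apply: ler_wpM2r; first by rewrite invr_ge0.
  rewrite ler_nat big_mkcond [leqRHS]big_mkcond; apply: leq_sum => k _.
  case: ifP => // /mem_multiplesP[c [Ec _] ck].
  by case: ifP => // /negP[]; apply/mem_multiplesP; exists c.
pose N := (Num.truncn (2 * Q%:R / (b - a))).+1.
have QN n : (N <= n)%N -> (0 < n)%N /\ Q%:R / n%:R < (b - a) / 2 :> R.
  move=> Nn; have n0 : (0 < n)%N by apply: leq_trans Nn.
  split=> //; rewrite ltr_pdivrMr ?ltr0n //.
  have : 2 * Q%:R / (b - a) < n%:R :> R.
    by apply: lt_le_trans (truncnS_gt _) _; rewrite ler_nat.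
  by rewrite ltr_pdivrMr ?subr_gt0 //; lra.
have [n Nn na] := Ea N; have [n0 Qn] := QN n Nn.
exists N => k Nk; have [k0 Qk] := QN k Nk.
have := freq_periodic_dist R (multiples F) Q k Q0 k0 Fper.
have := freq_periodic_dist R (multiples F) Q n Q0 n0 Fper.
by rewrite !ler_distl; have := FE n; lra.
Qed.

Lemma le_upper_density (R : realType) (A : set int) (d : R) :
  (forall N, exists2 n, (N <= n)%N & d <= freq R A n) -> d <= upper_density R A.
Proof.
move=> Ad; have bd : bounded_fun (freq R A).
  exists 1; split => // M M1 n _ /=.
  by case/andP: (freq_itv R A n) => f0 f1; rewrite ger0_norm // (le_trans f1) // ltW.
rewrite /upper_density limn_supE //; apply: lb_le_inf.
  by exists (sups (freq R A) 0%N), 0%N.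
move=> _ [N _ <-]; have [n Nn dn] := Ad N; apply: le_trans dn _.
apply: ub_le_sup; last by exists n.
by exists 1 => _ [k _ <-]; case/andP: (freq_itv R A k).
Qed.

(** * Choice of the bounds, positive upper density and tautification *)

Theorem proposition1p11 (R : realType) (E : set nat)
    (E_pos : E `<=` posn) (E_nonbes : ~ besicovitch R E) :
  exists bound : nat -> seq nat -> nat,
  forall (K : nat -> nat),
    (forall i, (1 <= i)%N ->
       (bound i [seq K j | j <- index_iota 1 i] < K i)%N) ->
  forall (A : nat -> set nat),
    (forall i, (1 <= i)%N ->
       A i !=set0 /\ A i `<=` [set n | (K i <= n)%N]) ->
  let E_ (i : nat) := E `&` [set n | (1 <= n < K i)%N] in
  let B := \bigcup_(i in [set i | (1 <= i)%N]) prodset (E_ i) (A i) in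
  0 < upper_density R (multiples E `\` multiples B) /\
  (taut R E -> (forall i, (1 <= i)%N -> behrend R (A i)) ->
   tautification R B = E).
Proof.
have [a [b [ab Ea Eb]]] := oscillation R _ (freq_itv R (multiples E)) E_nonbes.
(* The pair stands for an index and the maximum of the earlier [K i]; the chosen n becomes the bound
   for the next one. *)
have : forall jm : nat * nat, exists n, [/\ (jm.1 <= n)%N, (jm.2 <= n)%N,
    b < freq R (multiples E) n &
    freq R (multiples (E `&` [set k | 0 < k < jm.2]%N)) n < (a + b) / 2].
  move=> [j m] /=.
  have aab : a < (a + b) / 2 by lra.
  have [N FN] := freq_multiples_below R E a ((a + b) / 2) m aab Ea.
  have [n Nn bn] := Eb (maxn (maxn j m) N).
  by move: Nn; rewrite !geq_max => /andP[/andP[jn mn] Nn]; exists n; split => //; exact: FN.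
move=> /choice[nn nnP].
exists (fun j s => nn (j, \max_(x <- s) x)) => K Kgt A AK E_ B.
pose m j := \max_(x <- [seq K j | j <- index_iota 1 j]) x.
pose n j := nn (j, m j).
have nK j : (1 <= j)%N -> (n j < K j)%N by exact: Kgt.
have Km i j : (1 <= i < j)%N -> (K i <= m j)%N.
  move=> ij; apply: leq_bigmax_seq => //; apply/mapP; exists i => //.
  by rewrite mem_index_iota.
have jn j : (j <= n j)%N by case: (nnP (j, m j)).
have mn j : (m j <= n j)%N by case: (nnP (j, m j)).
have Kmono i j : (1 <= i <= j)%N -> (K i <= K j)%N.
  move=> /andP[i1]; rewrite leq_eqVlt => /predU1P[-> //|ij].
  apply: ltnW; apply: leq_ltn_trans (nK j _); last exact: leq_trans ij.
  by apply: leq_trans (mn j); apply: Km; rewrite i1.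
have BP x : B x -> exists i e y, [/\ (1 <= i)%N, E e, (1 <= e < K i)%N, A i y & x = (e * y)%N].
  by move=> [i i1 [e [Ee eK] [y Ay <-]]]; exists i, e, y.
split.
  (* The margin is b - (a + b)/2: the frequency of the multiples of [E] at [n j], less that of the
     multiples of the finite part. *)
  apply: (@lt_le_trans _ _ ((b - a) / 2)); first by lra.
  apply: le_upper_density => N; pose j := N.+1.
  exists (n j); first exact: ltnW (jn j).
  have [_ _ bE Fa] := nnP (j, m j); rewrite -/(n j) in bE Fa.
  move: Fa; set F := E `&` _ => Fa.
  suff : freq R (multiples E) (n j) <=
      freq R (multiples E `\` multiples B) (n j) + freq R (multiples F) (n j) by lra.
  rewrite /freq -mulrDl; apply: ler_wpM2r; first by rewrite invr_ge0.
  rewrite -natrD ler_nat [leqLHS]big_mkcond [X in (_ <= X + _)%N]big_mkcond.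
  rewrite [X in (_ <= _ + X)%N]big_mkcond -big_split /= big_nat_cond [leqRHS]big_nat_cond.
  apply: leq_sum => k /andP[/andP[k0 kn] _].
  case: ifP => // kE; case: ifP => // /negP kEB.
  suff -> : (k%:Z : int) \in multiples F by [].
  have /mem_multiplesP[x Bx xk] : (k%:Z : int) \in multiples B.
    apply: contrapT => kB; apply: kEB; rewrite in_setE; split.
      by rewrite in_setE in kE.
    by move=> ?; apply: kB; rewrite in_setE.
  have [i [e [y [i1 Ee /andP[e0 eK] Ay xE]]]] := BP _ Bx.
  have Ky : (K i <= y)%N by exact: (AK i i1).2.
  have yn : (y <= n j)%N.
    rewrite -ltnS; apply: leq_trans kn; rewrite ltnS.
    by apply: leq_trans (dvdn_leq k0 xk); rewrite xE leq_pmull.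
  (* If i >= j, then y >= K i >= K j > n j, against y <= k <= n j. Hence e < K i <= m j, which puts
     [e] in [F]. *)
  have ij : (i < j)%N.
    rewrite ltnNge; apply/negP => ji.
    have := nK j isT; have := Kmono j i; rewrite ji => /(_ isT).
    by move: Ky yn; lia.
  apply/mem_multiplesP; exists e; last by apply: dvdn_trans xk; rewrite xE dvdn_mulr.
  split=> //=; rewrite e0 /=; apply: leq_trans eK _; apply: Km; exact/andP.
move=> tE bA.
(* The index e + 1 works because e < e + 1 <= n (e + 1) < K (e + 1). *)
have EC e : E e -> behrend_divisors R B e.
  move=> Ee; have e0 : (0 < e)%N by exact: E_pos.
  split => //; exists (A e.+1); split; first exact: bA.
  move=> _ [y Ay <-]; exists e.+1 => //; exists e; last by exists y.
  split=> //=; rewrite e0 /=; apply: leq_trans (nK e.+1 isT).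
  by rewrite ltnS ltnW.
have A1 i y : (1 <= i)%N -> A i y -> (1 < y)%N.
  by move=> i1 Ay; have [/(_ _ Ay)[/= y0 /eqP y1] _] := bA i i1; case: y y0 y1 {Ay} => [|[|]].
have CE c : (B `|` behrend_divisors R B) c -> (0 < c)%N /\ exists2 e, E e & (e %| c)%N.
  move=> [/BP[i [e [y [i1 Ee /andP[e0 _] Ay ->]]]]|[c0 [D [bD DB]]]].
    split; last by exists e; rewrite ?dvdn_mulr.
    by rewrite muln_gt0 e0 ltnW // (A1 i).
  (* Each c * y lies in [B] and so has a divisor in [E]; tautness transfers such a divisor to
     [c]. *)
  split=> //; apply: (taut_divisor R E D c) => // y Dy.
  have [|i [e [z [_ Ee _ _ ->]]]] := BP (c * y)%N; first by apply: DB; exists y.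
  by exists e; rewrite ?dvdn_mulr.
apply/seteqP; split => [x [xBC xnp]|e Ee].
  have [x0 [e Ee /dvdnP[k xE]]] := CE _ xBC.
  (* A quotient k >= 2 contradicts primitivity, as [e] is itself in C(B). *)
  have [k1|] := leqP k 1; last first.
    by move=> k2; case: xnp; exists k => //; exists e => //; right; exact: EC.
  suff -> : x = e by [].
  by move: k1 x0; rewrite xE; case: k {xE} => [|[|]] //; rewrite mul1n.
split; first by right; exact: EC.
move=> [k /= k2 [x xBC xe]].
have [x0 [d Ed dx]] := CE _ xBC.
(* The divisor [d] of [x] also divides [e], so it equals [e]; then e = k * x <= x with k >= 2 is
   absurd. *)
have de : d = e.
  by apply: (taut_primitive R E d e tE Ed Ee); rewrite -xe dvdn_mull.
have := dvdn_leq x0 dx; rewrite de -xe.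
by move: x0 k2 {xBC dx xe}; nia.
Qed.
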